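(* Let $K_1\subset\mathbb{C}$ (resp. $K_2\subset\mathbb{C}$) be any compact set and $(\eta_j)_{j\ge0}\subset K_1$ (resp. $(\theta_i)_{i\ge0}\subset K_2$) any Leja sequence for it. Then the intertwining sequence of $(\eta_j)_{j\ge0}$ and $(\theta_i)_{i\ge0}$ is a (bidimensional) Leja sequence for the compact set $K_1\times K_2\subset\mathbb{C}^2$.
   Context: One-dimensional Leja sequence: for a compact set $E\subset\mathbb{C}$, a sequence $(\eta_j)_{j\ge0}$ of points of $E$ with $\eta_0\in\partial E$ and, for all $k\ge1$, $\sup_{z\in E}\prod_{j=0}^{k-1}|z-\eta_j|=\prod_{j=0}^{k-1}|\eta_k-\eta_j|$. Order $\mathbb{N}^2$ ($0\in\mathbb{N}$) by $(k_1,l_1)\le(k_2,l_2)$ iff $k_1+l_1<k_2+l_2$, or $k_1+l_1=k_2+l_2$ and $k_1\ge k_2$; this enumerates $\mathbb{N}^2$ as $(k(1),l(1)),(k(2),l(2)),\ldots=(0,0),(1,0),(0,1),(2,0),(1,1),\ldots$. Put $e_j(z,w)=z^{k(j)}w^{l(j)}$. The intertwining sequence of $(\eta_k)_{k\ge0}$ and $(\theta_l)_{l\ge0}$ is $H_j=(\eta_{k(j)},\theta_{l(j)})$, $j\ge1$. For points $x_1,\ldots,x_N\in\mathbb{C}^2$, $VDM(x_1,\ldots,x_N)=\det[e_i(x_j)]_{1\le i,j\le N}$. Bidimensional Leja sequence: for a compact $K\subset\mathbb{C}^2$, a sequence $(H_j)_{j\ge1}$ of points of $K$ such that for all $N\ge1$,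 $|VDM(H_1,\ldots,H_N,H_{N+1})|=\sup_{(z,w)\in K}|VDM(H_1,\ldots,H_N,(z,w))|$ (the first point $H_1\in K$ being arbitrary). *)

(* Defs.v *)
(* The complex plane is R[i] for R : realType. *)
From HB Require Import structures.
From mathcomp Require Import all_boot all_order all_algebra zify.
From mathcomp Require Import complex.
From mathcomp Require Import all_classical all_reals all_analysis.

Set Implicit Arguments.
Unset Strict Implicit.
Unset Printing Implicit Defensive.

Import Order.TTheory GRing.Theory Num.Theory.
Import numFieldNormedType.Exports.

Local Open Scope classical_set_scope.
Local Open Scope ring_scope.

(* Graded order on N^2: first by total degree, then by decreasing first
   exponent. *)
Definition deg_le (p q : nat * nat) : bool :=
  ((p.1 + p.2 < q.1 + q.2) ||
   ((p.1 + p.2 == q.1 + q.2) && (q.1 <= p.1)))%N.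

Definition deg_next (p : nat * nat) : nat * nat :=
  if p.1 is k.+1 then (k, p.2.+1) else (p.2.+1, 0%N).

(* (0,0), (1,0), (0,1), (2,0), (1,1), ...  The enumeration is 0-based:
   deg_enum n is (k(n+1), l(n+1)).  That it is the increasing enumeration of
   N^2 for deg_le is deg_enum_le together with deg_enum_surj. *)
Definition deg_enum (n : nat) : nat * nat := iter n deg_next (0%N, 0%N).

Lemma deg_enum_lt (m n : nat) :
  (m < n)%N -> ~~ deg_le (deg_enum n) (deg_enum m).
Proof.
elim: n => // n IH; rewrite ltnS leq_eqVlt => /orP[/eqP->|/IH];
  rewrite /deg_enum iterS -/(deg_enum n) -?/(deg_enum m) /deg_le /deg_next.
  by case: (deg_enum n) => -[|k] l /=; lia.
by case: (deg_enum n) (deg_enum m) => -[|k] l [k' l'] /=; lia.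
Qed.

Lemma deg_enum_le (m n : nat) :
  deg_le (deg_enum m) (deg_enum n) = (m <= n)%N.
Proof.
have [lt_nm|] := ltnP n m; first exact/negbTE/deg_enum_lt.
rewrite leq_eqVlt => /predU1P[->|/deg_enum_lt]; rewrite /deg_le; lia.
Qed.

Lemma deg_enum_surj (p : nat * nat) : exists n, deg_enum n = p.
Proof.
case: p => k l; move: {2}(k + l)%N (erefl (k + l)%N) => d.
elim: d k l => [|d IHd] k l; first by case: k l => [|k] [|l] //; exists 0%N.
elim: l k => [|l IHl] k kl.
  have [n En] : exists n, deg_enum n = (0%N, d) by apply: IHd.
  exists n.+1; rewrite /deg_enum iterS -/(deg_enum n) En /deg_next /=.
  by congr pair; lia.
have [n En] : exists n, deg_enum n = (k.+1, l) by apply: IHl; lia.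
by exists n.+1; rewrite /deg_enum iterS -/(deg_enum n) En.
Qed.

Definition boundary (T : topologicalType) (E : set T) : set T :=
  closure E `\` interior E.

(* As for the concrete Stdlib reals in Rstruct_topology, the topology of the
   norm has to be declared on the carrier R[i]. *)
HB.instance Definition _ (R : realType) :=
  PseudoPointedMetric.copy R[i] (R[i] : Type)^o.

Section Leja.
Variable R : realType.
Local Notation C := R[i].

(* The library norm `|z| takes its values in R[i]; this is the real modulus,
   needed for suprema. *)
Definition cmod (z : C) : R := complex.Re `|z|.

(* Suprema are taken in the extended reals, so that they never have a default
   value. *)
Definition leja1 (E : set C) (eta : nat -> C) : Prop :=
  [/\ compact E,
      forall j, E (eta j),
      boundary E (eta 0%N) &
      forall k, (0 < k)%N ->
        ereal_sup [set (\prod_(j < k) cmod (z - eta j))%:E | z in E]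
        = (\prod_(j < k) cmod (eta k - eta j))%:E].

Definition monom (n : nat) (p : C * C) : C :=
  p.1 ^+ (deg_enum n).1 * p.2 ^+ (deg_enum n).2.

Definition VDM (N : nat) (x : N.-tuple (C * C)) : C :=
  \det (\matrix_(i < N, j < N) monom i (tnth x j)).

(* Sequences in C^2 are indexed from 0: H n is the (n+1)-st point, so that
   [tuple H i | i < N] lists the first N points. *)
Definition intertwining (eta theta : nat -> C) (n : nat) : C * C :=
  (eta (deg_enum n).1, theta (deg_enum n).2).

Definition leja2 (K : set (C * C)) (H : nat -> C * C) : Prop :=
  [/\ compact K,
      forall n, K (H n) &
      forall N, (0 < N)%N ->
        (cmod (VDM [tuple H i | i < N.+1]))%:E
        = ereal_sup [set (cmod (VDM [tuple of rcons [tuple H i | i < N] p]))%:E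
                    | p in K]].

End Leja.

(* Main.v *)
(* Let q_k and r_l be the monic polynomials with roots eta_0, ..., eta_(k-1) and
   theta_0, ..., theta_(l-1).  The products q_k(z) r_l(w) are obtained from the
   monomials z^k w^l by a unitriangular change of basis for the graded order, so
   they have the same Vandermonde determinants.  As q_k(z) r_l(w) vanishes at
   every point of the intertwining sequence preceding (eta_k, theta_l), the
   matrix becomes triangular:
   VDM(H_1, ..., H_N, p) = c_N q_(k(N+1))(p_1) r_(l(N+1))(p_2) with c_N
   independent of p, and the two factors are maximised separately. *)
Require Import Defs.
From mathcomp Require Import all_boot all_order all_algebra zify.
From mathcomp Require Import complex.
From mathcomp Require Import all_classical all_reals all_analysis.

Import Order.TTheory GRing.Theory Num.Theory.
Import numFieldNormedType.Exports.

Local Open Scope classical_set_scope.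
Local Open Scope ring_scope.

Lemma deg_enum_inj : injective deg_enum.
Proof.
move=> m n e; apply/eqP; rewrite eqn_leq -!deg_enum_le e.
by rewrite deg_enum_le leqnn.
Qed.

(** The graded order extends the componentwise order: either the total degree is strictly smaller,
    or the two pairs coincide. *)
Lemma deg_enum_leq {m n : nat} :
  ((deg_enum m).1 <= (deg_enum n).1)%N ->
  ((deg_enum m).2 <= (deg_enum n).2)%N -> (m <= n)%N.
Proof. by move=> le1 le2; rewrite -deg_enum_le /deg_le; lia. Qed.

(** Source of both triangularities below: the coordinate that is exceeded kills a coefficient by
    degree, or a value by a root. *)
Lemma deg_enum_ltn (m n : nat) : (m < n)%N ->
  ((deg_enum m).1 < (deg_enum n).1)%N || ((deg_enum m).2 < (deg_enum n).2)%N.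
Proof.
apply: contraLR; rewrite negb_or -!leqNgt => /andP[*].
exact: deg_enum_leq.
Qed.

(** Once the zero terms are dropped, the two lists are permutations of each other. *)
Lemma eq_big_uniq_support (V : nmodType) (I : eqType) (s t : seq I) (F : I -> V) :
  uniq s -> uniq t ->
  (forall x, F x != 0 -> (x \in s) = (x \in t)) ->
  \sum_(x <- s) F x = \sum_(x <- t) F x.
Proof.
move=> us ut st.
have restrict u : \sum_(x <- u) F x = \sum_(x <- [seq x <- u | F x != 0]) F x.
  rewrite big_filter [RHS]big_mkcond; apply: eq_bigr => x _.
  by case: eqP.
rewrite [LHS]restrict [RHS]restrict.
apply/perm_big/uniq_perm; rewrite ?filter_uniq//.
by move=> x; rewrite !mem_filter; case: (F x =P 0) => //= /eqP /st.
Qed.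

Section NodePoly.
Variable F : idomainType.

Definition node_poly (x : nat -> F) (k : nat) : {poly F} :=
  \prod_(j < k) ('X - (x j)%:P).

Lemma size_node_poly x k : size (node_poly x k) = k.+1.
Proof. by rewrite size_prod_XsubC /index_enum unlock -enumT size_enum_ord. Qed.

Lemma coef_node_poly x k : (node_poly x k)`_k = 1.
Proof.
have /monicP : node_poly x k \is monic by apply: monic_prod_XsubC.
by rewrite lead_coefE size_node_poly.
Qed.

Lemma horner_node_poly x k z : (node_poly x k).[z] = \prod_(j < k) (z - x j).
Proof. by rewrite horner_prod; apply: eq_bigr => j _; rewrite hornerXsubC. Qed.

Lemma node_poly_root x k j : (j < k)%N -> (node_poly x k).[x j] = 0.
Proof.
by move=> jk; rewrite horner_node_poly (bigD1 (Ordinal jk))//= subrr mul0r.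
Qed.

End NodePoly.

Arguments node_poly {F} x k.

Section Vandermonde.
Variables (R : realType) (eta theta : nat -> R[i]).

Definition newton (n : nat) (p : R[i] * R[i]) : R[i] :=
  (node_poly eta (deg_enum n).1).[p.1] * (node_poly theta (deg_enum n).2).[p.2].

Definition newton_coef (n m : nat) : R[i] :=
  (node_poly eta (deg_enum n).1)`_(deg_enum m).1 *
  (node_poly theta (deg_enum n).2)`_(deg_enum m).2.

Lemma newton_coef_diag n : newton_coef n n = 1.
Proof. by rewrite /newton_coef !coef_node_poly mulr1. Qed.

Lemma newton_coef_gt n m : (n < m)%N -> newton_coef n m = 0.
Proof.
rewrite /newton_coef => /deg_enum_ltn /orP[] h.
  by rewrite nth_default ?mul0r// size_node_poly.
by rewrite [X in _ * X]nth_default ?mulr0// size_node_poly.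
Qed.

(** Expanding the product gives a sum over a rectangle of exponents. By [deg_enum_leq] the rectangle
    lies in the first [N] values of [deg_enum], and outside it one of the two coefficients
    vanishes. *)
Lemma newton_monomE {N n} p : (n < N)%N ->
  newton n p = \sum_(m < N) newton_coef n m * monom m p.
Proof.
move=> nN; rewrite /newton !horner_coef !size_node_poly.
set q := node_poly eta _; set r := node_poly theta _.
pose T (x : nat * nat) : R[i] := q`_x.1 * r`_x.2 * (p.1 ^+ x.1 * p.2 ^+ x.2).
have iotaE k : iota 0 k = index_iota 0 k by rewrite /index_iota subn0.
pose rect := [seq (a, b) | a <- iota 0 (deg_enum n).1.+1,
                           b <- iota 0 (deg_enum n).2.+1].
transitivity (\sum_(x <- rect) T x).
  rewrite big_allpairs iotaE big_mkord big_distrl.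
  apply: eq_bigr => a _.
  rewrite iotaE big_mkord big_distrr /=.
  by apply: eq_bigr => b _; rewrite /T /= mulrACA.
transitivity (\sum_(x <- map deg_enum (iota 0 N)) T x); last first.
  by rewrite big_map iotaE big_mkord.
apply: eq_big_uniq_support.
- by apply: allpairs_uniq; rewrite ?iota_uniq// => -[? ?] [? ?].
- by rewrite map_inj_uniq ?iota_uniq//; exact: deg_enum_inj.
move=> x; have [m <-{x}] := deg_enum_surj x => Tm.
have [le1 le2] : ((deg_enum m).1 <= (deg_enum n).1)%N /\
                 ((deg_enum m).2 <= (deg_enum n).2)%N.
  split; rewrite leqNgt; apply: contra_neqN Tm => h.
    by rewrite /T [q`__]nth_default ?mul0r// size_node_poly.
  by rewrite /T [r`__]nth_default ?mulr0 ?mul0r// size_node_poly.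
rewrite (mem_map deg_enum_inj) mem_iota /= add0n.
rewrite (leq_ltn_trans (deg_enum_leq le1 le2) nN).
by case: (deg_enum m) le1 le2 => a b /= *; apply/allpairsP; exists (a, b);
  rewrite !mem_iota !add0n !ltnS.
Qed.

Lemma newton_intertwining n m : (m < n)%N ->
  newton n (intertwining eta theta m) = 0.
Proof.
rewrite /newton => /deg_enum_ltn /orP[] h.
  by rewrite node_poly_root ?mul0r.
by rewrite [X in _ * X]node_poly_root ?mulr0.
Qed.

(** The Newton matrix is [L] times the monomial matrix, with [L] lower unitriangular. *)
Lemma VDM_newton N (x : N.-tuple (R[i] * R[i])) :
  VDM x = \det (\matrix_(i < N, j < N) newton i (tnth x j)).
Proof.
pose L : 'M[R[i]]_N := \matrix_(i < N, j < N) newton_coef i j.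
have detL : \det L = 1.
  rewrite det_trig; last first.
    by apply/is_trig_mxP => i j ij; rewrite mxE newton_coef_gt.
  by apply: big1 => i _; rewrite mxE newton_coef_diag.
rewrite -[LHS]mul1r -detL /VDM -det_mulmx; congr (\det _).
apply/matrixP => i j; rewrite !mxE (newton_monomE _ (ltn_ord i)).
by apply: eq_bigr => m _; rewrite !mxE.
Qed.

Lemma VDM_rcons_intertwining N p :
  VDM [tuple of rcons [tuple intertwining eta theta i | i < N] p] =
  (\prod_(i < N) newton i (intertwining eta theta i)) * newton N p.
Proof.
set x := [tuple of _].
have xE (j : 'I_N.+1) :
    tnth x j = if (j < N)%N then intertwining eta theta j else p.
  (* Taking [p] as the default of [nth] merges the last entry with the out-of-range case. *)
  rewrite (tnth_nth p) /= nth_rcons size_map size_enum_ord if_same.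
  case: ltnP => // jN.
  by rewrite (nth_map (Ordinal jN)) ?size_enum_ord// nth_enum_ord.
(* [newton i] vanishes at the points before the [i]-th, so the matrix is upper triangular;
   [det_trig] expects a lower triangular one, hence the transpose. The point [p] fills only the last
   column, so it enters the determinant through one diagonal entry. *)
rewrite VDM_newton -det_tr det_trig; last first.
  apply/is_trig_mxP => i j ij; rewrite !mxE xE.
  have iN : (i < N)%N by apply: leq_trans ij _; rewrite -ltnS.
  by rewrite iN newton_intertwining.
rewrite big_ord_recr /= !mxE xE ltnn; congr (_ * _).
by apply: eq_bigr => i _; rewrite !mxE xE /= ltn_ord.
Qed.

Lemma tuple_intertwiningS N :
  [tuple intertwining eta theta i | i < N.+1] =
  [tuple of rcons [tuple intertwining eta theta i | i < N]
                  (intertwining eta theta N)].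
Proof.
have enumE M : [seq intertwining eta theta (val i) | i <- enum 'I_M] =
               map (intertwining eta theta) (iota 0 M).
  by rewrite -val_enum_ord -map_comp.
by apply/val_inj; rewrite /= !enumE -addn1 iotaD map_cat cats1.
Qed.

End Vandermonde.

Section Modulus.
Variable R : realType.

Lemma cmod_ge0 (z : R[i]) : 0 <= cmod z.
Proof. by case: z => a b; rewrite /cmod normc_def /= sqrtr_ge0. Qed.

Lemma cmodM : {morph @cmod R : x y / x * y}.
Proof.
move=> x y; rewrite /cmod normrM !normc_def /=.
by rewrite !mulr0 subr0.
Qed.

Lemma cmod_prod (k : nat) (f : nat -> R[i]) :
  cmod (\prod_(j < k) f j) = \prod_(j < k) cmod (f j).
Proof.
by apply: (big_morph _ cmodM); rewrite /cmod normr1.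
Qed.

Lemma cmod_node_poly (x : nat -> R[i]) (k : nat) (z : R[i]) :
  cmod (node_poly x k).[z] = \prod_(j < k) cmod (z - x j).
Proof. by rewrite horner_node_poly (cmod_prod k (fun j => z - x j)). Qed.

Lemma leja1_max {E : set R[i]} {eta : nat -> R[i]} (k : nat) {z : R[i]} :
  leja1 E eta -> E z ->
  cmod (node_poly eta k).[z] <= cmod (node_poly eta k).[eta k].
Proof.
move=> [_ _ _ maxE] Ez; rewrite !cmod_node_poly.
(* The Leja condition starts at index 1; at 0 both products are empty. *)
case: k => [|k]; first by rewrite !big_ord0.
by rewrite -lee_fin -maxE//; apply: ereal_sup_ubound; exists z.
Qed.

End Modulus.

Theorem theorem4 (R : realType) (K1 K2 : set R[i])
    (compactK1 : compact K1) (compactK2 : compact K2)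
    (eta theta : nat -> R[i])
    (leja_eta : leja1 K1 eta) (leja_theta : leja1 K2 theta) :
  leja2 (K1 `*` K2) (intertwining eta theta).
Proof.
have [_ K1eta _ _] := leja_eta; have [_ K2theta _ _] := leja_theta.
have KH n : (K1 `*` K2) (intertwining eta theta n).
  by split; [exact: K1eta | exact: K2theta].
split=> //; first exact: compact_setX.
move=> N _; rewrite tuple_intertwiningS.
apply/eqP; rewrite eq_le; apply/andP; split.
  by apply: ereal_sup_ubound; exists (intertwining eta theta N) => //; exact: KH.
apply: ge_ereal_sup => _ [[z w] [/= K1z K2w] <-].
(* The common factor is removed by monotonicity, not division, so it may be zero, as happens when
   Leja points repeat on a finite set. *)
rewrite lee_fin !VDM_rcons_intertwining !cmodM ler_wpM2l ?cmod_ge0//=.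
by rewrite ler_pM ?cmod_ge0// (leja1_max _ _ leja_eta, leja1_max _ _ leja_theta).
Qed.
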